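(* Let $G$ be a finite group that contains a section isomorphic to one of the following groups: (i) a dihedral group $D_{2n}$ with $n\geq 3$ odd; (ii) a non-abelian $P$-group of order $p^{n-1}q$, where $n\geq 2$ and $p>2$, $q$ are primes with $q\mid p-1$; (iii) a symmetric group $S_n$ with $n\geq 3$; (iv) an alternating group $A_n$ with $n\geq 4$. Then $G$ is not nilpotent.
   Context: A section of $G$ is a quotient group $H/K$, where $H$ is a subgroup of $G$ and $K$ is a normal subgroup of $H$. $D_{2n}$ denotes the dihedral group of order $2n$. For primes $p>2$ and $q$ with $q\mid p-1$ and an integer $n\geq 2$, a non-abelian $P$-group of order $p^{n-1}q$ is a semidirect product $A\rtimes\langle b\rangle$ of an elementary abelian normal $p$-subgroup $A$ of order $p^{n-1}$ by a cyclic group $\langle b\rangle$ of order $q$ that induces a nontrivial power automorphism on $A$; that is, there is an integer $r$ with $r\not\equiv 1 \pmod p$ and $r^q\equiv 1\pmod p$ such that $b^{-1}ab=a^r$ for all $a\in A$. *)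

(* Defs.v *)
From mathcomp Require Import all_boot all_fingroup all_solvable.

Set Implicit Arguments.
Unset Strict Implicit.
Unset Printing Implicit Defensive.

Local Open Scope group_scope.

Definition has_section (gT rT : finGroupType) (G : {set gT}) (X : {set rT}) : Prop :=
  exists H K : {group gT}, [/\ H \subset G, K <| H & H / K \isog X].

(* The non-abelian P-groups of order p ^ (n - 1) * q, meant for n >= 2 and      *)
(* primes p > 2 and q with q %| p - 1. Semidirect product is internal and       *)
(* includes the normality of A; a ^ b is conjugation, b^-1 * a * b. Since A has *)
(* exponent p, a ^+ r only depends on r modulo p, so that the integer r can be  *)
(* taken in nat.                                                                *)
Definition nonabelian_Pgroup (p q n : nat) (rT : finGroupType) (M : {group rT}) : Prop :=
  exists (A : {group rT}) (b : rT),
    [/\ A ><| <[b]> = M,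
        p.-abelem A,
        #|A| = (p ^ (n - 1))%N,
        #[b] = q
      & exists r : nat,
          [/\ r <> 1 %[mod p],
              (r ^ q)%N = 1 %[mod p]
            & {in A, forall a, a ^ b = a ^+ r}]].

(* Main.v *)
Require Import Defs.
From mathcomp Require Import all_boot all_fingroup all_solvable.

Local Open Scope group_scope.

(** In a nilpotent group, elements of coprime orders commute, because the group
    is the direct product of its Sylow subgroups; and nilpotency passes to
    subgroups, quotients and isomorphic copies, hence to sections.  So [G] is not
    nilpotent as soon as one of its sections contains two elements of coprime
    orders that do not commute ([section_not_nilpotent]).  Each of the four
    families contains such a pair:
    - in a dihedral group of order [2n], [n] odd, a rotation of order [n] and a
      reflection, which inverts it;
    - in a non-abelian P-group, an element [a != 1] of [A], of order [p], and
      [b], of order [q], which maps [a] to [a ^+ r] with [r] not 1 modulo [p];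
    - in a symmetric group, a 3-cycle and a transposition;
    - in an alternating group, a 3-cycle and a double transposition. *)

Lemma nilpotent_coprime_commute {gT : finGroupType} {G : {group gT}} {x y : gT}
    {m k : nat} :
  nilpotent G -> x \in G -> y \in G -> x ^+ m = 1 -> y ^+ k = 1 ->
  coprime m k -> commute x y.
Proof.
move=> nilG Gx Gy /eqP xm /eqP yk co_mk.
rewrite -order_dvdn in xm; rewrite -order_dvdn in yk.
apply/cent1P; rewrite -cent_cycle -cycle_subG.
apply: (sub_nilpotent_cent2 nilG); rewrite ?cycle_subG //.
by rewrite coprime_sym -!orderE (coprime_dvdl xm) ?(coprime_dvdr yk).
Qed.

Lemma section_nilpotent {gT rT : finGroupType} {G : {group gT}}
    {X : {group rT}} :
  has_section G X -> nilpotent G -> nilpotent X.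
Proof.
case=> H [K [sHG _ isoX]] nilG.
by rewrite -(isog_nil isoX) quotient_nil // (nilpotentS sHG).
Qed.

Lemma section_not_nilpotent {gT rT : finGroupType} {G : {group gT}}
    {X : {group rT}} {x y : rT} (m k : nat) :
  has_section G X -> x \in X -> y \in X -> x ^+ m = 1 -> y ^+ k = 1 ->
  coprime m k -> ~ commute x y -> ~~ nilpotent G.
Proof.
move=> secX Xx Xy xm yk co_mk ncxy; apply/negP=> /(section_nilpotent secX) nilX.
exact: ncxy (nilpotent_coprime_commute nilX Xx Xy xm yk co_mk).
Qed.

(** A rotation [x] that commutes with the reflection inverting it satisfies
    [x ^+ 2 = 1], so [x = 1] since [n] is odd; but then the reflection alone
    would generate the group, whose order [2n] exceeds 2. *)
Lemma dihedral_noncommuting {n : nat} :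
  2 < n -> odd n ->
  exists x y : 'D_(2 * n), [/\ x ^+ n = 1, y ^+ 2 = 1 & ~ commute x y].
Proof.
move=> n_gt2 odd_n; have n_gt1 := ltnW n_gt2; rewrite mul2n.
have := isoGrp_hom (Grp_dihedral n_gt1).
case/existsP=> -[x y] /= /eqP[genD xn y2 xy]; exists x, y; split=> // cxy.
have x2: x ^+ 2 = 1.
  by rewrite expgS expg1 -{2}(mulKg y x) -cxy -conjgE xy mulgV.
have x1: x = 1.
  have /eqP gcd_n2 : coprime n 2 by rewrite coprimen2.
  apply/eqP; rewrite -(expg1 x) -order_dvdn -gcd_n2 dvdn_gcd.
  by rewrite !order_dvdn xn x2 eqxx.
have := card_dihedral n_gt1; rewrite -genD x1 cycle1 joing1G -orderE => oy.
have /dvdn_leq: #[y] %| 2 by rewrite order_dvdn y2.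
by rewrite oy -addnn => /(_ isT); rewrite leqNgt ltn_addr.
Qed.

Lemma nonabelian_Pgroup_noncommuting {p q n : nat} {rT : finGroupType}
    {M : {group rT}} :
  1 < n -> prime p -> nonabelian_Pgroup p q n M ->
  exists x y : rT,
    [/\ x \in M, y \in M, x ^+ p = 1, y ^+ q = 1 & ~ commute x y].
Proof.
move=> n_gt1 p_pr [A [b [defM abelA oA ob [r [r_neq1 _ actb]]]]].
have [_ mulAb _ _] := sdprodP defM.
have /trivgPn[a Aa nta]: A :!=: 1.
  by rewrite -cardG_gt1 oA (ltn_exp2l 0) ?prime_gt1 // subn_gt0.
have oa: #[a] = p by apply: abelem_order_p abelA Aa nta.
exists a, b; split.
- by rewrite -mulAb (subsetP (mulG_subl _ _)).
- by rewrite -mulAb (subsetP (mulG_subr _ _)) ?cycle_id.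
- by rewrite -oa expg_order.
- by rewrite -ob expg_order.
(* If [b] centralised [a], then [a ^+ r = a] and [r] would be 1 modulo [#[a]]. *)
move=> cab; apply: r_neq1; apply/eqP; rewrite -oa -eq_expg_mod_order expg1.
by rewrite -actb // conjgE cab mulKg.
Qed.

(** Permutations compose from left to right, so [tperm a b * tperm b c] is the
    3-cycle a -> c -> b -> a. *)
Lemma tperm_mul_tperm_expg3 {T : finType} {a b c : T} :
  a != b -> a != c -> b != c -> (tperm a b * tperm b c) ^+ 3 = 1.
Proof.
move=> ab ac bc; have conj_eq: tperm a b ^ tperm b c = tperm b c ^ tperm a b.
  rewrite !tpermJ tpermL tpermR [tperm b c a]tpermD 1?eq_sym //.
  by rewrite [tperm a b c]tpermD.
(* With s and t the two involutions, both conjugates being the transposition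
   of a and c is the braid relation t s t = s t s, and
   (s t)^3 = (s t s) (t s t) = (t s t)^2 = 1. *)
move: conj_eq; rewrite !conjgE !tpermV !mulgA => braid.
rewrite !expgS expg0 mulg1 !mulgA -braid -!mulgA.
rewrite (mulgA _ _ (tperm a b * _)) tperm2 mul1g.
by rewrite (mulgA _ _ (tperm b c)) !tperm2 mul1g tperm2.
Qed.

(** The 3-cycle followed by [tperm a b] maps [a] to [c]; composed in the other
    order, they fix [a]. *)
Lemma tperm_3cycle_noncommuting {T : finType} {a b c : T} :
  a != b -> a != c -> b != c ->
  ~ commute (tperm a b * tperm b c) (tperm a b).
Proof.
move=> ab ac bc /(congr1 (fun s : {perm T} => s a)).
rewrite !permM !tpermL !tpermR (tpermD ac bc) tpermD 1?eq_sym // => eq_ca.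
by rewrite eq_ca eqxx in ac.
Qed.

Lemma double_tperm_expg2 {T : finType} {a b c d : T} :
  uniq [:: a; b; c; d] -> (tperm a b * tperm c d) ^+ 2 = 1.
Proof.
rewrite /= !inE !negb_or -!andbA => /and4P[ab ac ad /and4P[bc bd cd _]].
have comm_tperm : commute (tperm a b) (tperm c d).
  by apply/commgP/conjg_fixP; rewrite tpermJ !tpermD 1?eq_sym.
by rewrite expgMn // !expgS !expg0 !mulg1 !tperm2 mulg1.
Qed.

(** The 3-cycle followed by the double transposition maps [a] to [d]; composed
    in the other order, they fix [a]. *)
Lemma double_tperm_3cycle_noncommuting {T : finType} {a b c d : T} :
  uniq [:: a; b; c; d] ->
  ~ commute (tperm a b * tperm b c) (tperm a b * tperm c d).
Proof.
rewrite /= !inE !negb_or -!andbA => /and4P[ab ac ad /and4P[bc bd cd _]].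
move=> /(congr1 (fun s : {perm T} => s a)).
rewrite !permM !tpermL (tpermD ac bc) tpermL.
rewrite (tpermD (z := b)) 1?eq_sym // tpermR tpermD 1?eq_sym // => eq_da.
by rewrite eq_da eqxx in ad.
Qed.

Theorem corollary2 (gT : finGroupType) (G : {group gT}) :
  [\/ exists n : nat,
        [/\ 3 <= n, odd n & has_section G [set: 'D_(2 * n)]],
      exists p q n : nat,
        [/\ 2 <= n, [/\ prime p, 2 < p & prime q], q %| p - 1
          & exists (rT : finGroupType) (M : {group rT}),
              nonabelian_Pgroup p q n M /\ has_section G M],
      exists n : nat, 3 <= n /\ has_section G 'Sym_('I_n)
    | exists n : nat, 4 <= n /\ has_section G 'Alt_('I_n)] ->
  ~~ nilpotent G.
Proof.
case.
- case=> n [n_gt2 odd_n secG].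
  have [x [y [xn y2 ncxy]]] := dihedral_noncommuting n_gt2 odd_n.
  by apply: (section_not_nilpotent n 2 secG) ncxy; rewrite ?inE ?coprimen2.
- case=> p [q [n [n_gt1 [p_pr _ q_pr] q_dvd [rT [M [PM secG]]]]]].
  have [x [y [Mx My xp yq ncxy]]] :=
    nonabelian_Pgroup_noncommuting n_gt1 p_pr PM.
  apply: (section_not_nilpotent p q secG) ncxy => //.
  apply: coprime_dvdr q_dvd _; rewrite subn1.
  by rewrite coprimenP ?prime_gt0.
- case=> -[|[|[|n]]] [] // _ secG.
  pose i (k : nat) : 'I_n.+3 := inord k.
  have ab: i 0%N != i 1%N by rewrite -val_eqE /= !inordK.
  have ac: i 0%N != i 2%N by rewrite -val_eqE /= !inordK.
  have bc: i 1%N != i 2%N by rewrite -val_eqE /= !inordK.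
  apply: (section_not_nilpotent 3 2 secG) (tperm_3cycle_noncommuting ab ac bc);
    rewrite ?inE ?tperm_mul_tperm_expg3 //.
  by rewrite expgS expg1 tperm2.
- case=> -[|[|[|[|n]]]] [] // _ secG.
  pose i (k : nat) : 'I_n.+4 := inord k.
  have uniq_i: uniq [:: i 0%N; i 1%N; i 2%N; i 3%N].
    by rewrite /= !inE -!val_eqE /= !inordK.
  have ncxy := double_tperm_3cycle_noncommuting uniq_i.
  have := uniq_i; rewrite /= !inE !negb_or -!andbA.
  case/and4P=> ab ac ad /and4P[bc bd cd _].
  apply: (section_not_nilpotent 3 2 secG) ncxy => //.
  + by rewrite Alt_even odd_permM !odd_tperm ab bc.
  + by rewrite Alt_even odd_permM !odd_tperm ab cd.
  + exact: tperm_mul_tperm_expg3.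
  + exact: double_tperm_expg2.
Qed.
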